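(* Let $\alpha,\beta\in\mathbb{C}$ with $\mathrm{Re}(\beta)>-1$, and let $n\ge 1$ be an integer such that none of the numbers $\alpha k+\beta+1$ ($0\le k\le n$) is a non-positive integer (this is automatic if $\alpha$ is a positive integer). Then for all $z\in\mathbb{C}$, $$ L_n^{(\alpha,\beta)}(z)=\left|\begin{array}{ccccc} B_{n,1}-\frac{z}{n}&1&0&\cdots&0\\ B_{n,2}&B_{n-1,1}-\frac{z}{n-1}&1&&\vdots\\ B_{n,3}&B_{n-1,2}&&\ddots&0\\ \vdots&\vdots&&B_{2,1}-\frac{z}{2}&1\\ B_{n,n}&B_{n-1,n-1}&\cdots&B_{2,2}&B_{1,1}-z \end{array}\right|. $$ That is, $L_n^{(\alpha,\beta)}(z)$ is the determinant of the $n\times n$ matrix whose $(r,c)$ entry ($1\le r,c\le n$) is $B_{n-c+1,1}-\frac{z}{n-c+1}$ if $r=c$, is $B_{n-c+1,\,r-c+1}$ if $r>c$, is $1$ if $c=r+1$, and is $0$ if $c>r+1$. In particular, when $\alpha=1$, $$ L_n^{(1,\beta)}(z)=\left|\begin{array}{ccccc} B_{n,1}-\frac{z}{n}&1&0&\cdots&0\\ B_{n,2}&B_{n-1,1}-\frac{z}{n-1}&1&&\vdots\\ 0&B_{n-1,2}&&\ddots&0\\ \vdots&\ddots&&B_{2,1}-\frac{z}{2}&1\\ 0&\cdots&0&B_{2,2}&B_{1,1}-z \end{array}\right|, $$ i.e. $L_n^{(1,\beta)}(z)$ is the determinant of the tridiagonal $n\times n$ matrix with diagonal entries $B_{n-c+1,1}-\frac{z}{n-c+1}$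 in column $c$ ($1\le c\le n$), subdiagonal entries $B_{n-c+1,2}$ in position $(c+1,c)$ ($1\le c\le n-1$), and superdiagonal entries $1$.
   Context: For an integer $n\ge 0$, the polynomial $L_n^{(\alpha,\beta)}(z)$ (the case $q=1$ of the generalized Laguerre polynomials $L_{\lfloor n/q\rfloor}^{(\alpha,\beta)}(z)$) is $$ L_n^{(\alpha,\beta)}(z)=\frac{\Gamma(\alpha n+\beta+1)}{\Gamma(n+1)}\sum_{k=0}^{n}\frac{(-n)^{(k)}}{\Gamma(\alpha k+\beta+1)}\frac{z^k}{k!}, $$ where $(\gamma)^{(k)}=\gamma(\gamma+1)\cdots(\gamma+k-1)$ is the rising factorial (with $(\gamma)^{(0)}=1$). In particular $L_0^{(\alpha,\beta)}(z)=1$. The falling factorial is $(\gamma)_s:=\Gamma(\gamma+1)/\Gamma(\gamma-s+1)$, used here also for the indices $s=\alpha$ and $s=(m-1)\alpha$ by this Gamma-function formula, with the convention that $1/\Gamma$ takes the value $0$ at the poles of $\Gamma$. For integers $n\ge m\ge 1$ put $$ C_{n,m}=C_{n,m}(\alpha,\beta):=\frac{1}{m!\,n}\sum_{j=0}^m(-1)^j\binom{m}{j}(n-j)\bigl(\alpha(n-j)+\beta\bigr)_{\alpha}, \qquad B_{n,m}:=\bigl(\alpha(n-1)+\beta\bigr)_{(m-1)\alpha}\,C_{n,m}. $$ *)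

(* Defs.v *)
From HB Require Import structures.
From mathcomp Require Import all_boot all_order all_algebra.
From mathcomp Require Import complex.
From mathcomp Require Import all_classical all_reals all_analysis.

Set Implicit Arguments.
Unset Strict Implicit.
Unset Printing Implicit Defensive.

Import Order.TTheory GRing.Theory Num.Theory.
Import numFieldNormedType.Exports.

Local Open Scope classical_set_scope.
Local Open Scope ring_scope.
Local Open Scope complex_scope.

Definition cexp (R : realType) (z : R[i]) : R[i] :=
  (expR (complex.Re z))%:C *
  (cos (complex.Im z) +i* sin (complex.Im z)).

Definition rising (R : realType) (g : R[i]) (k : nat) : R[i] :=
  \prod_(i < k) (g + i%:R).

Definition nonpos_int (R : realType) (z : R[i]) : Prop :=
  exists j : nat, z = - j%:R.

(* Gauss's product formula
     Gamma(z) = lim_(N -> oo) N! N^z / (z (z + 1) ... (z + N)),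
   valid at every z that is not a pole, with N^z = exp (z ln N).  At a pole the
   denominator is eventually 0, so division by 0 gives the junk value 0. *)
Definition Gamma (R : realType) (z : R[i]) : R[i] :=
  limn (fun N : nat => (
    N`!%:R * cexp (z * (ln (N%:R : R))%:C) / rising z N.+1) : R[i]^o).

(* 1 / Gamma, extended by 0 at the poles of Gamma. *)
Definition rGamma (R : realType) (z : R[i]) : R[i] :=
  if `[< nonpos_int z >] then 0 else (Gamma z)^-1.

(* The index s is complex. *)
Definition falling (R : realType) (g s : R[i]) : R[i] :=
  Gamma (g + 1) * rGamma (g - s + 1).

Definition L (R : realType) (alpha beta : R[i]) (n : nat) (z : R[i]) : R[i] :=
  Gamma (alpha * n%:R + beta + 1) / Gamma (n%:R + 1) *
  \sum_(0 <= k < n.+1)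
     rising (- n%:R) k * rGamma (alpha * k%:R + beta + 1) * (z ^+ k / k`!%:R).

(* Meaningful for 1 <= m <= n, the only case in which C and B are used. *)
Definition C (R : realType) (alpha beta : R[i]) (n m : nat) : R[i] :=
  1 / (m`!%:R * n%:R) *
  \sum_(0 <= j < m.+1)
     (-1) ^+ j * 'C(m, j)%:R * (n%:R - j%:R) *
     falling (alpha * (n%:R - j%:R) + beta) alpha.

Definition B (R : realType) (alpha beta : R[i]) (n m : nat) : R[i] :=
  falling (alpha * (n%:R - 1) + beta) ((m%:R - 1) * alpha) *
  C alpha beta n m.

(* Rows and columns are numbered from 0: the indices (r, c) here stand for the
   position (r + 1, c + 1) in the usual numbering from 1. *)
Definition laguerre_mx (R : realType) (alpha beta : R[i]) (n : nat)
    (z : R[i]) : 'M[R[i]]_n :=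
  \matrix_(r < n, c < n)
    if r == c :> nat then B alpha beta (n - c) 1 - z / (n - c)%:R
    else if (c < r)%N then B alpha beta (n - c) (r - c + 1)
    else if c == r.+1 :> nat then 1
    else 0.

Definition laguerre_tridiag_mx (R : realType) (beta : R[i]) (n : nat)
    (z : R[i]) : 'M[R[i]]_n :=
  \matrix_(r < n, c < n)
    if r == c :> nat then B 1 beta (n - c) 1 - z / (n - c)%:R
    else if r == c.+1 :> nat then B 1 beta (n - c) 2
    else if c == r.+1 :> nat then 1
    else 0.

(* Main.v *)
Require Import Defs.
From mathcomp Require Import all_boot all_order all_algebra.
From mathcomp Require Import complex.
From mathcomp Require Import all_classical all_reals all_analysis.
From mathcomp Require Import ring lra zify.
Set Implicit Arguments.
Unset Strict Implicit.
Unset Printing Implicit Defensive.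
Import Order.TTheory GRing.Theory Num.Theory.
Import numFieldNormedType.Exports.
Local Open Scope classical_set_scope.
Local Open Scope ring_scope.
Local Open Scope complex_scope.

(**
Put g_k = Gamma (alpha k + beta + 1) and f_k = k g_k / g_(k-1), with f_0 = 0.
Apart from Gamma (n + 1), all Gamma factors of the statement are values g_k, or
occur with the coefficient n - j = 0, so that everything is expressed through g:
  L_n = g_n sum_k (-z)^k / (k! (n-k)! g_k),
  B_(n,m) = (g_(n-1) / g_(n-m)) (1 / (m! n)) sum_j (-1)^j C(m,j) f_(n-j).

The matrix is lower Hessenberg with 1 above the diagonal.  If D_0 = 1 and
  D_n = sum_(m = 1..n) (-1)^(m-1) M_(n,m) D_(n-m),
where M_(n,m) is the entry in row m of the first column of the matrix of
size n, then the alternating row vector of D_(n-1), ..., D_0 times the matrix is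
D_n times the first unit vector; Cramer's rule together with the unitriangular
corner minor shows that the determinant is D_n (det_hessenberg).

It remains to see that L_n satisfies this recurrence, for arbitrary nonzero g_k
(laguerre_of_rec).  Comparing the coefficients of z^k / g_k, the recurrence says
  (f_n - f_k) / (n-k)! = sum_m (-1)^(m-1) (nabla^m f)_n / (m! (n-k-m)!),
which is the expansion of shift^(n-k) = (1 - nabla)^(n-k), where nabla is the
backward difference; in other words, the binomial transform is an involution
(fdiffK).  For alpha = 1 the sequence f_k = k (k + beta) is quadratic, so its
differences of order at least 3 vanish and the matrix becomes tridiagonal.

The analytic input is that Gamma, defined by Gauss's limit, exists and is nonzero
outside its poles, satisfies Gamma (z + 1) = z Gamma z, and extends the factorial.
Both the Gauss approximants u_N and their inverses change by a factor
1 + O (1/N - 1/(N+1)) at each step.  Such a sequence is bounded and has increments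
dominated by those of K/N, hence converges (cvg_ratio); as both u_N and 1/u_N
converge, the limit of u_N is nonzero.
*)

(** * Alternating binomial sums as finite differences *)

(** [((1 - T)^m h) 0], with [T] the shift of sequences. *)
Definition fdiff (F : comNzRingType) (m : nat) (h : nat -> F) : F :=
  \sum_(j < m.+1) (-1) ^+ j * 'C(m, j)%:R * h j.

Lemma eq_fdiff (F : comNzRingType) (m : nat) (h1 h2 : nat -> F) :
  (forall j, (j <= m)%N -> h1 j = h2 j) -> fdiff m h1 = fdiff m h2.
Proof. by move=> e; apply: eq_bigr => j _; rewrite e// -ltnS. Qed.

Lemma fdiff0 (F : comNzRingType) (h : nat -> F) : fdiff 0 h = h 0%N.
Proof. by rewrite /fdiff big_ord1 bin0 expr0 !mul1r. Qed.

Lemma fdiffS (F : comNzRingType) (m : nat) (h : nat -> F) :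
  fdiff m.+1 h = fdiff m (fun j => h j - h j.+1).
Proof.
rewrite /fdiff; under [RHS]eq_bigr do rewrite mulrBr.
rewrite sumrB [in LHS]big_ord_recl.
under [X in _ + X = _]eq_bigr => j _ do rewrite /= /bump /= add1n binS natrD mulrDr mulrDl.
rewrite big_split /= addrA; congr (_ + _).
  rewrite [RHS]big_ord_recl [in LHS]big_ord_recr /= (bin_small (ltnSn m)) mulr0 mul0r addr0.
  by rewrite !bin0; congr (_ + _); apply: eq_bigr.
by rewrite -sumrN; apply: eq_bigr => j _; rewrite exprS mulN1r !mulNr.
Qed.

Lemma fdiffSB (F : comNzRingType) (m : nat) (h : nat -> F) :
  fdiff m.+1 h = fdiff m h - fdiff m (fun j => h j.+1).
Proof.
by rewrite fdiffS /fdiff -sumrB; apply: eq_bigr => j _; rewrite mulrBr.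
Qed.

(** The binomial transform is an involution, since [1 - (1 - T) = T]. *)
Lemma fdiffK (F : comNzRingType) (N : nat) (h : nat -> F) :
  fdiff N (fun m => fdiff m h) = h N.
Proof.
elim: N h => [|N IHN] h; first by rewrite !fdiff0.
rewrite fdiffS -[RHS]/((fun j => h j.+1) N) -IHN.
by apply: eq_fdiff => m _; rewrite fdiffSB subKr.
Qed.

(** Each difference lowers the degree of a polynomial sequence by one. *)
Lemma fdiff_quadratic (F : comNzRingType) (a b c : F) (m : nat) :
  (2 < m)%N -> fdiff m (fun j => a + b * j%:R + c * j%:R ^+ 2) = 0.
Proof.
case: m => [|[|[|m]]]// _; rewrite !fdiffS /fdiff big1// => j _.
by rewrite -!natr1; ring.
Qed.

(** * Determinants of Hessenberg matrices *)

(** [M k m] is the entry in row [m] (from 1) of the first column of the lower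
    right [k] by [k] block, so that the same [M] serves matrices of all sizes. *)
Definition hessenberg (F : comNzRingType) (n : nat) (M : nat -> nat -> F) : 'M[F]_n :=
  \matrix_(r < n, c < n)
    if (c <= r)%N then M (n - c)%N (r - c).+1
    else if c == r.+1 :> nat then 1 else 0.

(** The recurrence says exactly that the alternating vector [w] of the values [D]
    is mapped by the matrix to a multiple of the first unit vector.  Multiplying
    by the adjugate and reading the last coordinate leaves only the minor without
    last row and first column, which is unitriangular. *)
Lemma det_hessenberg (F : comNzRingType) (M : nat -> nat -> F) (D : nat -> F) (n : nat) :
  D 0%N = 1 ->
  (forall k, (0 < k <= n)%N ->
     D k = \sum_(m < k) (-1) ^+ m * M k m.+1 * D (k - m.+1)%N) ->
  \det (hessenberg n M) = D n.
Proof.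
move=> D0; case: n => [_|n DE]; first by rewrite det_mx00.
set A := hessenberg _ _.
pose w : 'rV[F]_n.+1 := \row_r ((-1) ^+ r * D (n - r)%N).
have wA : w *m A = D n.+1 *: delta_mx 0 0.
  apply/rowP => c; rewrite !mxE/=.
  have tail : \sum_(r < n.+1 | (c <= r)%N) w 0 r * A r c = (-1) ^+ c * D (n.+1 - c)%N.
    rewrite DE ?subn_gt0 ?ltn_ord ?leq_subr// mulr_sumr.
    pose G r := w 0 (inord r) * A (inord r) c.
    transitivity (\sum_(r < n.+1 | (c <= r)%N) G r).
      by apply: eq_bigr => r _; rewrite /G inord_val.
    rewrite -(big_geq_mkord _ _ xpredT) -{1}[c : nat]add0n big_addn big_mkord.
    apply: eq_bigr => m _; have mr : (m + c < n.+1)%N by rewrite addnC -ltn_subRL.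
    rewrite /G !mxE inordK// leq_addl addnK exprD -!mulrA.
    rewrite [D _ * _]mulrC mulrCA; congr (_ * (_ * (_ * D _))).
    have := ltn_ord m; have := ltn_ord c; lia.
  have [c0|c0] := eqVneq c 0.
    have := tail; rewrite c0 subn0 expr0 mul1r mulr1 => <-.
    exact: eq_bigl.
  rewrite mulr0.
  have c_gt0 : (0 < c)%N by rewrite lt0n.
  have predc : (c.-1 < n.+1)%N by rewrite (leq_ltn_trans (leq_pred c)).
  rewrite (bigID (fun r : 'I_n.+1 => (c <= r)%N))/= tail.
  rewrite (bigD1 (Ordinal predc)) /= -?ltnNge ?prednK// big1 ?addr0.
    rewrite !mxE /= (leqNgt c) prednK// leqnn eqxx mulr1 -{1}(prednK c_gt0) exprS.
    by rewrite (_ : n - c.-1 = n.+1 - c)%N ?mulN1r ?mulNr ?addNr//; lia.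
  move=> r; rewrite -ltnNge => /andP[rc rc'].
  rewrite !mxE leqNgt rc /= ifF ?mulr0//.
  by apply/negbTE; apply: contraNneq rc' => cE; apply/eqP/val_inj; rewrite /= cE.
have /(congr1 (fun B : 'rV_n.+1 => B 0 ord_max)) : w *m (A *m \adj A) = D n.+1 *: delta_mx 0 0 *m \adj A.
  by rewrite mulmxA wA.
rewrite mul_mx_adj mul_mx_scalar -scalemxAl -rowE !mxE subnn D0 mulr1 /cofactor.
have -> : \det (row' ord_max (col' 0 A)) = 1.
  rewrite det_trig.
    by rewrite big1// => i _; rewrite !mxE lift_max lift0 ltnn eqxx.
  apply/is_trig_mxP => i j ij.
  rewrite !mxE lift_max lift0 ltnNge ltnW//= ifF// eqSS.
  by rewrite gtn_eqF.
rewrite addn0 mulr1 => /(congr1 (fun x => x * (-1) ^+ n)).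
by rewrite -!mulrA -exprD addnn -mul2n exprM sqrrN !expr1n !mulr1.
Qed.

(** * The Laguerre recurrence over an abstract sequence *)

(** The Laguerre polynomial when the values [Gamma (alpha * k + beta + 1)] are
    replaced by an arbitrary sequence [g]. *)
Definition laguerre_of (F : numFieldType) (g : nat -> F) (n : nat) (z : F) : F :=
  g n * \sum_(k < n.+1) (- z) ^+ k / (k`!%:R * (n - k)`!%:R * g k).

Definition weighted_ratio (F : numFieldType) (g : nat -> F) (k : nat) : F :=
  k%:R * (g k / g k.-1).

Definition differenceB (F : numFieldType) (g : nat -> F) (n m : nat) : F :=
  g n.-1 / g (n - m)%N *
  (fdiff m (fun j => weighted_ratio g (n - j)) / (m`!%:R * n%:R)).

Definition laguerre_entry (F : numFieldType) (g : nat -> F) (z : F) (n m : nat) : F :=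
  differenceB g n m - (if m == 1%N then z / n%:R else 0).

Lemma natr_fact_neq0 (F : numFieldType) (k : nat) : k`!%:R != 0 :> F.
Proof. by rewrite pnatr_eq0 -lt0n fact_gt0. Qed.

(** [fdiffK] at [n - k], with the term [m = 0] moved to the left and the binomial
    coefficients written as quotients of factorials. *)
Lemma fdiff_inversion (F : numFieldType) (f : nat -> F) (n k : nat) :
  (k <= n)%N ->
  (f n - f k) / (n - k)`!%:R =
  \sum_(m < n - k) (-1) ^+ m * (fdiff m.+1 (fun j => f (n - j)%N) / m.+1`!%:R)
     / (n - k - m.+1)`!%:R.
Proof.
move=> kn; set h : nat -> F := fun j => f _; set N := (n - k)%N.
have fk : f k = fdiff N (fun m => fdiff m h) by rewrite fdiffK /h subKn.
rewrite fk /fdiff big_ord_recl /= -/(fdiff _ _) fdiff0 bin0 expr0 !mul1r {1}/h subn0.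
rewrite opprD addNKr -sumrN mulr_suml; apply: eq_bigr => m _.
rewrite /bump /= add1n -/(fdiff m.+1 h) exprS mulN1r !mulNr opprK.
rewrite -!mulrA; congr (_ * _); rewrite mulrCA; congr (_ * _).
have mN : (m.+1 <= N)%N by [].
apply/eqP; rewrite -(bin_fact mN) !natrM !invfM.
by rewrite mulVKf // pnatr_eq0 -lt0n bin_gt0.
Qed.

(** After division by [g n.-1 / n], the coefficients of each [a k] on both sides
    agree by [key], which is [fdiff_inversion].  The term in [z] supplies the part with
    [weighted_ratio g k], because [- z * a k = weighted_ratio g k.+1 * a k.+1]. *)
Lemma laguerre_of_rec (F : numFieldType) (g : nat -> F) (n : nat) (z : F) :
  (forall k, (k <= n)%N -> g k != 0) -> (0 < n)%N ->
  laguerre_of g n z =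
  \sum_(m < n) (-1) ^+ m * laguerre_entry g z n m.+1 * laguerre_of g (n - m.+1)%N z.
Proof.
case: n => // n g0 _; set f := weighted_ratio g.
pose a k := (- z) ^+ k / (k`!%:R * g k).
(* Extending 1 / (N - k)! by 0 lets all sums over k have the same range. *)
pose T N k : F := if (k <= N)%N then (N - k)`!%:R^-1 else 0.
have lagE N : (N <= n.+1)%N -> laguerre_of g N z = g N * \sum_(k < n.+2) a k * T N k.
  move=> Nn; rewrite /laguerre_of (big_ord_widen n.+2 (fun k => (- z) ^+ k / (k`!%:R * (N - k)`!%:R * g k)))//.
  congr (_ * _); rewrite big_mkcond; apply: eq_bigr => k _.
  by rewrite /T ltnS; case: ifP => _; rewrite ?mulr0// /a mulrAC invfM mulrA.
have n0 : n.+1%:R != 0 :> F by rewrite pnatr_eq0.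
have gn0 := g0 n (leqnSn n).
have key k : (k <= n.+1)%N -> f n.+1 * T n.+1 k = f k * T n.+1 k +
    \sum_(m < n.+1) (-1) ^+ m * (fdiff m.+1 (fun j => f (n.+1 - j)%N) / m.+1`!%:R) * T (n - m)%N k.
  move=> kn; apply/eqP; rewrite addrC -subr_eq -mulrBl {1}/T kn fdiff_inversion//.
  rewrite (big_ord_widen n.+1 (fun m => (-1) ^+ m * (fdiff m.+1 (fun j => f (n.+1 - j)%N) / m.+1`!%:R)
     / (n.+1 - k - m.+1)`!%:R)) ?leq_subr// big_mkcond; apply/eqP/eq_bigr => m _.
  rewrite /T (_ : (k <= n - m) = (m < n.+1 - k))%N; last by have := ltn_ord m; lia.
  case: ifP => _; rewrite ?mulr0//; congr (_ * (_ `! %:R)^-1).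
  by have := ltn_ord m; lia.
have shift : - z * \sum_(k < n.+2) a k * T n k = \sum_(k < n.+2) f k * (a k * T n.+1 k).
  rewrite big_ord_recr /= /T ltnn mulr0 addr0 [RHS]big_ord_recl /f /weighted_ratio mul0r mul0r add0r.
  rewrite mulr_sumr; apply: eq_bigr => k _; rewrite lift0 ltnS subSS /=.
  case: ifP => _; rewrite ?mulr0// /a factS natrM exprS.
  have k0 : k.+1%:R != 0 :> F by rewrite pnatr_eq0.
  have gk0 : g k != 0 by apply: g0; have := ltn_ord k; lia.
  have gk1 : g k.+1 != 0 by apply: g0; have := ltn_ord k; lia.
  have := natr_fact_neq0 F k; have := natr_fact_neq0 F (n - k) => h1 h2.
  by field; rewrite h1 h2 gk0 gk1 nat1r k0.
have -> : laguerre_of g n.+1 z = g n / n.+1%:R * (f n.+1 * \sum_(k < n.+2) a k * T n.+1 k).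
  by rewrite lagE// /f /weighted_ratio /=; field; rewrite nat1r n0 gn0.
have mainE : f n.+1 * (\sum_(k < n.+2) a k * T n.+1 k) = - z * (\sum_(k < n.+2) a k * T n k) +
   \sum_(m < n.+1) (-1) ^+ m * (fdiff m.+1 (fun j => f (n.+1 - j)%N) / m.+1`!%:R) * \sum_(k < n.+2) a k * T (n - m)%N k.
  rewrite shift; under [X in _ = _ + X]eq_bigr do rewrite mulr_sumr.
  rewrite exchange_big -big_split mulr_sumr /=; apply: eq_bigr => k _.
  rewrite mulrCA key -1?ltnS// mulrDr; congr (_ + _); first by rewrite mulrCA.
  by rewrite mulr_sumr; apply: eq_bigr => m _; rewrite mulrCA.
have -> : \sum_(m < n.+1) (-1) ^+ m * laguerre_entry g z n.+1 m.+1 * laguerre_of g (n.+1 - m.+1)%N z =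
    - (z / n.+1%:R) * laguerre_of g n z + \sum_(m < n.+1) (-1) ^+ m * differenceB g n.+1 m.+1 * laguerre_of g (n - m)%N z.
  rewrite !big_ord_recl /= addrA; congr (_ + _).
    by rewrite /laguerre_entry eqxx expr0 subSS subn0; ring.
  by apply: eq_bigr => m _; rewrite /laguerre_entry /bump /= add1n subr0 subSS.
rewrite mainE mulrDr lagE//; congr (_ + _); first by field; rewrite ?nat1r n0 ?gn0.
rewrite mulr_sumr; apply: eq_bigr => m _.
have gm0 : g (n - m)%N != 0 by apply: g0; rewrite leqW// leq_subr.
rewrite lagE; last by rewrite leqW// leq_subr.
rewrite /differenceB -/f subSS /=.
have := natr_fact_neq0 F m.+1 => h1.
by field; rewrite nat1r n0 h1 gm0.
Qed.

Lemma det_laguerre_of (F : numFieldType) (g : nat -> F) (n : nat) (z : F) :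
  (forall k, (k <= n)%N -> g k != 0) ->
  \det (hessenberg n (laguerre_entry g z)) = laguerre_of g n z.
Proof.
move=> g0; apply: det_hessenberg (fun k => laguerre_of g k z) _ _ _.
  by rewrite /laguerre_of big_ord1 expr0 fact0 !mul1r divff// g0.
move=> k /andP[k0 kn]; apply: laguerre_of_rec => // j jk; apply: g0; exact: leq_trans kn.
Qed.

(** * Moduli and componentwise convergence of complex numbers *)

(** The modulus with values in [R]: the norm of [R[i]] takes its values in [R[i]]. *)
Definition cnorm (R : realType) (z : R[i]) : R := Normc.normc z.

Lemma cnorm_ge0 (R : realType) (z : R[i]) : 0 <= cnorm z.
Proof. by case: z => a b; rewrite /cnorm sqrtr_ge0. Qed.

Lemma Re_le_cnorm (R : realType) (z : R[i]) : `|complex.Re z| <= cnorm z.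
Proof.
by case: z => a b; rewrite /cnorm /=; rewrite -sqrtr_sqr ler_wsqrtr// lerDl sqr_ge0.
Qed.

Lemma Im_le_cnorm (R : realType) (z : R[i]) : `|complex.Im z| <= cnorm z.
Proof.
by case: z => a b; rewrite /cnorm /=; rewrite -sqrtr_sqr ler_wsqrtr// lerDr sqr_ge0.
Qed.

Lemma cnorm_le (R : realType) (z : R[i]) :
  cnorm z <= `|complex.Re z| + `|complex.Im z|.
Proof.
case: z => a b; rewrite /cnorm /=; rewrite -(ler_sqr (sqrtr_ge0 _)) ?nnegrE ?addr_ge0//.
rewrite sqr_sqrtr ?addr_ge0 ?sqr_ge0// sqrrD !real_normK ?num_real//.
by rewrite lerD2r lerDl mulrn_wge0// mulr_ge0.
Qed.

Lemma norm_cnorm (R : realType) (z : R[i]) : `|z| = (cnorm z)%:C.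
Proof. by case: z. Qed.

Lemma cvg_complex (R : realType) (u : nat -> R[i]) (l : R[i]) :
  complex.Re (u N) @[N --> \oo] --> complex.Re l ->
  complex.Im (u N) @[N --> \oo] --> complex.Im l ->
  (u : nat -> R[i]^o) @ \oo --> (l : R[i]^o).
Proof.
move=> /cvgrPdist_lt ul /cvgrPdist_lt vl; apply/cvgrPdist_lt => -[e e'].
rewrite ltcE /= => /andP[/eqP -> e0].
have e20 : 0 < e / 2 by rewrite divr_gt0.
near=> N.
have h1 : `|complex.Re l - complex.Re (u N)| < e / 2 by near: N; exact: ul.
have h2 : `|complex.Im l - complex.Im (u N)| < e / 2 by near: N; exact: vl.
rewrite norm_cnorm -[e +i* 0]/(e%:C) ltcR.
apply: le_lt_trans (cnorm_le _) _.
move: h1 h2; clear; case: l => a b; case: (u N) => c d /=; lra.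
Unshelve. all: by end_near.
Qed.

(** * Convergence of sequences with summable relative increments *)

(** [v - K / N] is nondecreasing and [v + K / N] is nonincreasing; the second
    sequence bounds the first one. *)
Lemma cvg_telescope_bound (R : realType) (v : nat -> R) (K : R) (N0 : nat) :
  (forall N, (N0 <= N)%N -> `|v N.+1 - v N| <= K * (N.+1%:R^-1 - N.+2%:R^-1)) ->
  cvgn v.
Proof.
move=> dv.
pose w N := v (N + N0)%N - K * (N + N0).+1%:R^-1.
have w_nd : {homo w : n m / (n <= m)%N >-> n <= m}.
  apply/nondecreasing_seqP => N; rewrite /w addSn.
  have := dv (N + N0)%N (leq_addl _ _); rewrite ler_norml => /andP[+ _].
  by rewrite mulrBr; move: (K / (N + N0).+1%:R) (K / (N + N0).+2%:R) => x y; lra.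
pose w' N := v (N + N0)%N + K * (N + N0).+1%:R^-1.
have w'_ni : {homo w' : n m / (n <= m)%N >-> n >= m}.
  apply/nonincreasing_seqP => N; rewrite /w' addSn.
  have := dv (N + N0)%N (leq_addl _ _); rewrite ler_norml => /andP[_].
  by rewrite mulrBr; move: (K / (N + N0).+1%:R) (K / (N + N0).+2%:R) => x y; lra.
have K0 : 0 <= K.
  have := le_trans (normr_ge0 _) (dv N0 (leqnn _)).
  rewrite pmulr_lge0// subr_gt0 ltf_pV2 ?posrE// ltr_nat//.
have cw : cvgn w.
  apply: nondecreasing_is_cvgn => //; exists (w' 0%N) => _ [N _ <-].
  apply: (@le_trans _ _ (w' N)); last exact: w'_ni.
  have : 0 <= K * (N + N0).+1%:R^-1 by rewrite mulr_ge0.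
  by rewrite /w /w'; move: (K / (N + N0).+1%:R) => x x0; lra.
have : cvgn (fun N => v (N + N0)%N).
  have -> : (fun N => v (N + N0)%N) = w \+ (fun N => K * (N + N0).+1%:R^-1).
    by apply/funext => N; rewrite /w /= subrK.
  apply: is_cvgD => //; apply: is_cvgM; first exact: is_cvg_cst.
  apply: (cvgP (0 : R)); rewrite (cvg_shiftn N0 (@harmonic R)).
  exact: cvg_harmonic.
by move=> /cvg_ex[l]; rewrite (cvg_shiftn N0 v) => /cvgP.
Qed.

Lemma cnorm_triangle (R : realType) (x y : R[i]) : cnorm (x + y) <= cnorm x + cnorm y.
Proof. exact: le_normcD. Qed.

Lemma cnormM (R : realType) (x y : R[i]) : cnorm (x * y) = cnorm x * cnorm y.
Proof. exact: Normc.normcM. Qed.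

(** The factors are at most [expR (K * (1 / N.+1 - 1 / N.+2))], whose product
    telescopes; hence [u] is bounded and the real and imaginary parts of its
    increments telescope as well. *)
Lemma cvg_ratio (R : realType) (u : nat -> R[i]) (K : R) (N0 : nat) :
  0 <= K ->
  (forall N, (N0 <= N)%N ->
    cnorm (u N.+1 - u N) <= cnorm (u N) * (K * (N.+1%:R^-1 - N.+2%:R^-1))) ->
  exists l : R[i], (u : nat -> R[i]^o) @ \oo --> (l : R[i]^o).
Proof.
move=> K0 du.
pose M := cnorm (u N0) * expR K.
have d_ge0 N : 0 <= N.+1%:R^-1 - N.+2%:R^-1 :> R.
  by rewrite subr_ge0 lef_pV2 ?posrE// ler_nat.
have uM N : (N0 <= N)%N -> cnorm (u N) <= M.
  move=> N0N; apply: (@le_trans _ _ (cnorm (u N0) * expR (K * (1 - N.+1%:R^-1)))); last first.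
    rewrite ler_wpM2l ?cnorm_ge0// ler_expR.
    by rewrite ler_piMr// gerBl invr_ge0.
  elim: N N0N => [|N IHN].
    rewrite leqn0 => /eqP ->; rewrite invr1 subrr mulr0 expR0 mulr1//.
  rewrite leq_eqVlt ltnS => /orP[/eqP ->|N0N].
    rewrite ler_peMr ?cnorm_ge0// -[leLHS]expR0 ler_expR mulr_ge0// subr_ge0.
    by rewrite invf_le1// ler1n.
  have -> : u N.+1 = u N + (u N.+1 - u N) by rewrite addrC subrK.
  apply: le_trans (cnorm_triangle _ _) _.
  apply: le_trans (lerD (lexx _) (du _ N0N)) _.
  rewrite -{1}[cnorm (u N)]mulr1 -mulrDr.
  have -> : 1 - N.+2%:R^-1 = (1 - N.+1%:R^-1) + (N.+1%:R^-1 - N.+2%:R^-1) :> R.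
    by rewrite addrA subrK.
  rewrite [K * (_ + (_ - _))]mulrDr expRD mulrA ler_pM ?cnorm_ge0 ?IHN// ?expR_ge1Dx//.
  by rewrite addr_ge0// mulr_ge0.
have duM N : (N0 <= N)%N -> cnorm (u N.+1 - u N) <= M * K * (N.+1%:R^-1 - N.+2%:R^-1).
  by move=> N0N; apply: le_trans (du _ N0N) _; rewrite -mulrA ler_wpM2r ?uM// mulr_ge0.
have ReB (x y : R[i]) : complex.Re (x - y) = complex.Re x - complex.Re y.
  by case: x; case: y.
have ImB (x y : R[i]) : complex.Im (x - y) = complex.Im x - complex.Im y.
  by case: x; case: y.
have /cvg_ex[a ua] : cvgn (fun N => complex.Re (u N)).
  apply: (@cvg_telescope_bound _ _ (M * K) N0) => N /duM; apply: le_trans.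
  by rewrite -ReB Re_le_cnorm.
have /cvg_ex[b ub] : cvgn (fun N => complex.Im (u N)).
  apply: (@cvg_telescope_bound _ _ (M * K) N0) => N /duM; apply: le_trans.
  by rewrite -ImB Im_le_cnorm.
by exists (a +i* b); apply: cvg_complex.
Qed.

(** * Second order bounds for the exponential *)

(** Applied to a function and then to its derivative, the mean value theorem gives
    explicit first and second order Taylor remainders for exp, sin and cos. *)
Lemma mvt_bound (R : realType) (f df : R -> R) (M x : R) :
  (forall y : R, is_derive y (1 : R) f (df y)) ->
  (forall y, `|y| <= `|x| -> `|df y| <= M) ->
  `|f x - f 0| <= M * `|x|.
Proof.
move=> fdf dfM.
have cf : continuous f by move=> y; apply/differentiable_continuous/derivable1_diffP; have [] := fdf y.
have [x0|/ltW x0] := leP 0 x.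
  have [] := MVT_segment x0 (fun y _ => fdf y) (continuous_subspaceT cf) => c.
  rewrite in_itv/= => /andP[c0 cx] ->; rewrite subr0 normrM ler_wpM2r// dfM//.
  by rewrite !ger0_norm.
have [] := MVT_segment x0 (fun y _ => fdf y) (continuous_subspaceT cf) => c.
rewrite in_itv/= => /andP[c0 cx] e; rewrite -normrN opprB e sub0r normrM normrN ler_wpM2r// dfM//.
by rewrite !ler0_norm// lerN2.
Qed.

Lemma norm_sin_le (R : realType) (x : R) : `|sin x| <= `|x|.
Proof.
have := @mvt_bound R sin cos 1 x (fun y => is_derive_sin y) (fun y _ => cos_max y).
by rewrite sin0 subr0 mul1r.
Qed.

Lemma norm_cosB1_le (R : realType) (x : R) : `|cos x - 1| <= x ^+ 2.
Proof.
have := @mvt_bound R cos (fun y => - sin y) `|x| x (fun y => is_derive_cos y).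
rewrite cos0 -normrM -expr2 ger0_norm ?sqr_ge0//; apply => y yx.
by rewrite normrN (le_trans (norm_sin_le _)).
Qed.

Lemma norm_expRB1_le (R : realType) (x : R) : `|expR x - 1| <= expR `|x| * `|x|.
Proof.
have := @mvt_bound R expR expR (expR `|x|) x (fun y => is_derive_expR y).
rewrite expR0; apply => y yx.
by rewrite ger0_norm ?expR_ge0// ler_expR (le_trans (ler_norm _)).
Qed.

Lemma norm_expR_taylor (R : realType) (x : R) : `|expR x - 1 - x| <= expR `|x| * x ^+ 2.
Proof.
have := @mvt_bound R (fun y => expR y - y) (fun y => expR y - 1) (expR `|x| * `|x|) x.
rewrite expR0 subr0 -addrAC -mulrA -normrM -expr2 (@ger0_norm _ (x ^+ 2)) ?sqr_ge0//; apply => y yx.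
by rewrite (le_trans (norm_expRB1_le _))// ler_pM ?expR_ge0// ler_expR.
Qed.

Lemma norm_sin_taylor (R : realType) (x : R) : `|sin x - x| <= x ^+ 2.
Proof.
have := @mvt_bound R (fun y => sin y - y) (fun y => cos y - 1) (`|x|) x.
rewrite sin0 !subr0 -normrM -expr2 ger0_norm ?sqr_ge0//; apply => y yx.
have := @mvt_bound R cos (fun y => - sin y) 1 y (fun y => is_derive_cos y).
rewrite cos0 mul1r => /(_ _)/le_trans -> // t _.
by rewrite normrN sin_max.
Qed.

Lemma cnorm_real (R : realType) (x : R) : cnorm x%:C = `|x|.
Proof. by rewrite /cnorm /= expr0n addr0 sqrtr_sqr. Qed.

Lemma cnormN (R : realType) (x : R[i]) : cnorm (- x) = cnorm x.
Proof. exact: normcN. Qed.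

Lemma cnorm1 (R : realType) : cnorm (1 : R[i]) = 1.
Proof. exact: Normc.normc1. Qed.

Lemma cnormV (R : realType) (x : R[i]) : cnorm x^-1 = (cnorm x)^-1.
Proof. exact: Normc.normcV. Qed.

Lemma cexpD (R : realType) (x y : R[i]) : cexp (x + y) = cexp x * cexp y.
Proof.
case: x => a b; case: y => c d; rewrite /cexp /= expRD cosD sinD.
by simpc; congr (_ +i* _); ring.
Qed.

Lemma cexp0 (R : realType) : cexp (0 : R[i]) = 1.
Proof. by rewrite /cexp /= expR0 cos0 sin0 mul1r. Qed.

Lemma cexpNM (R : realType) (x : R[i]) : cexp (- x) * cexp x = 1.
Proof. by rewrite -cexpD addNr cexp0. Qed.

Lemma cexp_neq0 (R : realType) (x : R[i]) : cexp x != 0.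
Proof.
by apply/eqP => e; have /eqP := cexpNM x; rewrite e mulr0 eq_sym oner_eq0.
Qed.

Lemma cexp_real (R : realType) (x : R) : cexp x%:C = (expR x)%:C.
Proof. by rewrite /cexp /= cos0 sin0 mulr1. Qed.

Lemma cnorm_cexp (R : realType) (x : R[i]) : cnorm (cexp x) <= expR (cnorm x).
Proof.
rewrite /cexp cnormM cnorm_real ger0_norm ?expR_ge0//.
rewrite {2}/cnorm /= cos2Dsin2 sqrtr1 mulr1 ler_expR.
exact: le_trans (ler_norm _) (Re_le_cnorm _).
Qed.

(** The real part of the remainder is [(expR a - 1 - a) + expR a * (cos b - 1)] and
    the imaginary part is [expR a * (sin b - b) + (expR a - 1) * b]; each of the
    four terms is at most [expR r * r ^+ 2] with [r] the modulus of [x]. *)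
Lemma cnorm_cexp_taylor (R : realType) (x : R[i]) :
  cnorm (cexp x - 1 - x) <= 4 * expR (cnorm x) * cnorm x ^+ 2.
Proof.
apply: le_trans (cnorm_le _) _; have := Re_le_cnorm x; have := Im_le_cnorm x.
have := cnorm_ge0 x; move: (cnorm x) => r r0.
case: x => a b; rewrite /cexp /= !mul0r subr0 addr0 subr0 => br ar.
have Er : expR `|a| <= expR r by rewrite ler_expR.
have ar2 : a ^+ 2 <= r ^+ 2 by rewrite -real_normK ?num_real// ler_sqr ?nnegrE.
have br2 : b ^+ 2 <= r ^+ 2 by rewrite -real_normK ?num_real// ler_sqr ?nnegrE.
have e1 : `|expR a - 1 - a| <= expR r * r ^+ 2.
  by rewrite (le_trans (norm_expR_taylor _))// ler_pM ?expR_ge0 ?sqr_ge0.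
have e2 : `|expR a * (cos b - 1)| <= expR r * r ^+ 2.
  rewrite normrM ler_pM// ?(le_trans (norm_cosB1_le _))//.
  by rewrite ger0_norm ?expR_ge0// ler_expR (le_trans (ler_norm _)).
have e3 : `|expR a * (sin b - b)| <= expR r * r ^+ 2.
  rewrite normrM ler_pM// ?(le_trans (norm_sin_taylor _))//.
  by rewrite ger0_norm ?expR_ge0// ler_expR (le_trans (ler_norm _)).
have e4 : `|(expR a - 1) * b| <= expR r * r ^+ 2.
  rewrite normrM expr2 mulrA ler_pM// (le_trans (norm_expRB1_le _))//.
  by rewrite ler_pM ?expR_ge0.
have -> : expR a * cos b - 1 - a = (expR a - 1 - a) + expR a * (cos b - 1) by ring.
have -> : expR a * sin b - b = expR a * (sin b - b) + (expR a - 1) * b by ring.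
have := ler_normD (expR a - 1 - a) (expR a * (cos b - 1)).
have := ler_normD (expR a * (sin b - b)) ((expR a - 1) * b).
lra.
Qed.

(** * Gauss's product converges to a nonzero limit *)

Definition gauss (R : realType) (z : R[i]) (N : nat) : R[i] :=
  N`!%:R * cexp (z * (ln (N%:R : R))%:C) / rising z N.+1.

Lemma risingS (R : realType) (z : R[i]) (k : nat) :
  rising z k.+1 = rising z k * (z + k%:R).
Proof. by rewrite /rising big_ord_recr. Qed.

Lemma addn_nonpole (R : realType) (z : R[i]) (k : nat) :
  ~ nonpos_int z -> z + k%:R != 0.
Proof. by move=> zP; apply/eqP => /eqP; rewrite addr_eq0 => /eqP zk; apply: zP; exists k. Qed.

Lemma rising_neq0 (R : realType) (z : R[i]) (k : nat) :
  ~ nonpos_int z -> rising z k != 0.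
Proof. by move=> zP; apply/prodf_neq0 => i _; exact: addn_nonpole. Qed.

Lemma gauss_neq0 (R : realType) (z : R[i]) (N : nat) :
  ~ nonpos_int z -> gauss z N != 0.
Proof.
move=> zP; apply: mulf_neq0; last by rewrite invr_eq0 rising_neq0.
by apply: mulf_neq0; rewrite ?cexp_neq0// pnatr_eq0 -lt0n fact_gt0.
Qed.

Definition lnstep (R : realType) (N : nat) : R := ln N.+2%:R - ln N.+1%:R.

Lemma lnstep_bounds (R : realType) (N : nat) :
  N.+2%:R^-1 <= lnstep R N <= N.+1%:R^-1.
Proof.
have p1 : 0 < N.+1%:R :> R by [].
have p2 : 0 < N.+2%:R :> R by [].
have e2 : N.+2%:R = N.+1%:R + 1 :> R by rewrite natr1.
apply/andP; split.
  have := @le_ln1Dx R (- N.+2%:R^-1).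
  have -> : 1 + - N.+2%:R^-1 = N.+1%:R / N.+2%:R :> R.
    by move: p2; rewrite e2; move: (N.+1%:R : R) => x x0; field; rewrite gt_eqF.
  rewrite ln_div// /lnstep ltrN2 invf_lt1// ltr1n => /(_ isT).
  by rewrite lerNr opprB.
have := @le_ln1Dx R (N.+1%:R^-1).
have -> : 1 + N.+1%:R^-1 = N.+2%:R / N.+1%:R :> R.
  by rewrite e2; move: (N.+1%:R : R) p1 => x x0; field; rewrite gt_eqF.
by rewrite ln_div//; apply; rewrite (@lt_trans _ _ 0)// ?invr_gt0//.
Qed.

(** Consecutive approximants differ by the factor
    [N.+2^z N.+1^(-z) / (1 + z / N.+2)]; stated without division. *)
Lemma gaussS (R : realType) (z : R[i]) (N : nat) : ~ nonpos_int z ->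
  gauss z N.+2 * (1 + z / N.+2%:R) = gauss z N.+1 * cexp (z * (lnstep R N)%:C).
Proof.
move=> zP; rewrite /gauss [rising z N.+3]risingS factS natrM.
have -> : (ln (N.+2%:R : R))%:C = (ln N.+1%:R)%:C + (lnstep R N)%:C.
  by rewrite -[RHS]rmorphD /= /lnstep addrC subrK.
rewrite [z * (_ + _)]mulrDr cexpD.
have := rising_neq0 N.+2 zP; have := addn_nonpole N.+2 zP => h1 h2.
have h3 : N.+2%:R != 0 :> R[i] by rewrite pnatr_eq0.
by move: (N.+2%:R : R[i]) h1 h3 => s h1 h3; field; rewrite h1 h2 h3.
Qed.

(** Since [lnstep R N] is [1 / N.+2] up to [1 / N.+1 - 1 / N.+2], and its square is
    of that same order, the exponential agrees with [1 + z / N.+2] to that order. *)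
Lemma cexp_lnstep (R : realType) (z : R[i]) (N : nat) :
  cnorm (cexp (z * (lnstep R N)%:C) - 1 - z / N.+2%:R) <=
  (8 * expR (cnorm z) * cnorm z ^+ 2 + cnorm z) * (N.+1%:R^-1 - N.+2%:R^-1).
Proof.
have /andP[] := lnstep_bounds R N; move: (lnstep R N) => d.
have -> : (N.+2%:R : R[i]) = (N.+2%:R : R)%:C by rewrite rmorph_nat.
have : N.+1%:R^-1 ^+ 2 <= 2 * (N.+1%:R^-1 - N.+2%:R^-1) :> R.
  have p1 : 1 <= N.+1%:R :> R by rewrite ler1n.
  have -> : N.+2%:R = N.+1%:R + 1 :> R by rewrite natr1.
  move: (N.+1%:R : R) p1 => x x1.
  have -> : 2 * (x^-1 - (x + 1)^-1) = x^-1 * (2 / (x + 1)).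
    by field; rewrite !gt_eqF//; lra.
  have x0 : 0 < x by lra.
  have xi : x^-1 <= 1 by rewrite invf_le1.
  rewrite expr2 ler_wpM2l ?invr_ge0 ?(ltW x0)// ler_pdivlMr; last lra.
  by rewrite mulrDr mulVf ?gt_eqF// mulr1; lra.
have : N.+1%:R^-1 <= 1 :> R by rewrite invf_le1// ler1n.
have : 0 < N.+2%:R^-1 :> R by rewrite invr_gt0.
rewrite -fmorphV /=.
move: (N.+1%:R^-1 : R) (N.+2%:R^-1 : R) => s h h0 s1 s2 hd ds.
have d0 : 0 <= d by lra.
have -> : cexp (z * d%:C) - 1 - z * h%:C =
    (cexp (z * d%:C) - 1 - z * d%:C) + z * (d - h)%:C.
  rewrite (_ : (d - h)%:C = d%:C - h%:C) ?rmorphB//.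
  by move: d%:C h%:C => x y; ring.
apply: le_trans (cnorm_triangle _ _) _.
have z0 := cnorm_ge0 z.
have t1 := cnorm_cexp_taylor (z * d%:C).
rewrite cnormM !cnorm_real !ger0_norm ?subr_ge0// in t1 *.
have t2 : expR (cnorm z * d) <= expR (cnorm z).
  by rewrite ler_expR ler_piMr//; lra.
have t3 : (cnorm z * d) ^+ 2 <= cnorm z ^+ 2 * (2 * (s - h)).
  rewrite exprMn ler_wpM2l ?sqr_ge0// (le_trans _ s2)// ler_sqr ?nnegrE//; lra.
have t4 : expR (cnorm z * d) * (cnorm z * d) ^+ 2 <= expR (cnorm z) * (cnorm z ^+ 2 * (2 * (s - h))).
  by rewrite ler_pM ?expR_ge0 ?sqr_ge0.
have t5 : cnorm z * (d - h) <= cnorm z * (s - h) by rewrite ler_wpM2l// lerB.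
rewrite -mulrA in t1; rewrite cnormM cnorm_real ger0_norm ?subr_ge0//.
apply: le_trans (lerD (le_trans t1 (ler_wpM2l _ t4)) t5) _; first by [].
by rewrite le_eqVlt; apply/orP; left; apply/eqP; ring.
Qed.

Section Gauss_cvg.
Variables (R : realType) (z : R[i]).
Hypothesis zP : ~ nonpos_int z.

Let K := 8 * expR (cnorm z) * cnorm z ^+ 2 + cnorm z.
(* Numerator minus denominator of the step factor of gauss. *)
Let E N := cexp (z * (lnstep R N)%:C) - 1 - z / N.+2%:R.

Let K_ge0 : 0 <= K.
Proof. by rewrite addr_ge0 ?mulr_ge0 ?expR_ge0 ?sqr_ge0 ?cnorm_ge0. Qed.

Let factor_neq0 N : 1 + z / N.+2%:R != 0.
Proof.
have n0 : N.+2%:R != 0 :> R[i] by rewrite pnatr_eq0.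
have -> : 1 + z / N.+2%:R = (z + N.+2%:R) / N.+2%:R.
  by rewrite mulrDl divff// addrC.
by rewrite mulf_neq0 ?invr_eq0// addn_nonpole.
Qed.

Lemma cvg_gauss : exists l : R[i], (gauss z : nat -> R[i]^o) @ \oo --> (l : R[i]^o).
Proof.
suff [l] : exists l : R[i], ((fun N => gauss z N.+1) : nat -> R[i]^o) @ \oo --> (l : R[i]^o).
  rewrite (_ : (fun N => gauss z N.+1) = (fun N => gauss z (N + 1)%N)); last first.
    by apply/funext => N; rewrite addn1.
  by rewrite (cvg_shiftn 1 (gauss z : nat -> R[i]^o)); exists l.
(* From N0 on, |z / N.+2| <= 1/2, which keeps 1 + z / N.+2 away from 0. *)
pose N0 := Num.bound (2 * cnorm z).
apply: (@cvg_ratio _ _ (2 * K) N0); first by rewrite mulr_ge0.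
move=> N N0N.
have -> : gauss z N.+2 - gauss z N.+1 = gauss z N.+1 * ((1 + z / N.+2%:R)^-1 * E N).
  have := gaussS N zP; rewrite /E => e; apply: (mulIf (factor_neq0 N)).
  rewrite mulrBl e -!mulrA [E N * _]mulrC mulKf ?factor_neq0//.
  by rewrite /E; ring.
rewrite cnormM ler_wpM2l ?cnorm_ge0// cnormM -mulrA.
rewrite ler_pM ?cnorm_ge0//; last exact: cexp_lnstep.
suff h : 2^-1 <= cnorm (1 + z / N.+2%:R).
  by rewrite cnormV -[2]invrK lef_pV2 ?posrE// (lt_le_trans _ h).
have t := cnorm_triangle (1 + z / N.+2%:R) (- (z / N.+2%:R)).
rewrite addrK cnorm1 cnormN in t.
suff : cnorm (z / N.+2%:R) <= 2^-1 by lra.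
rewrite cnormM cnormV -(rmorph_nat (real_complex R)) cnorm_real ger0_norm//.
rewrite ler_pdivrMr// mulrC ler_pdivlMr// mulrC.
apply: le_trans (ltW (archi_boundP _)) _; first by rewrite mulr_ge0 ?cnorm_ge0.
by rewrite ler_nat (leq_trans N0N)// leqW.
Qed.

(** Convergence of the inverses is what excludes the limit 0 for [gauss z]. *)
Lemma cvg_gaussV : exists l : R[i], ((fun N => (gauss z N)^-1) : nat -> R[i]^o) @ \oo --> (l : R[i]^o).
Proof.
suff [l] : exists l : R[i], ((fun N => (gauss z N.+1)^-1) : nat -> R[i]^o) @ \oo --> (l : R[i]^o).
  rewrite (_ : (fun N => (gauss z N.+1)^-1) = (fun N => (gauss z (N + 1)%N)^-1)); last first.
    by apply/funext => N; rewrite addn1.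
  by rewrite (cvg_shiftn 1 ((fun N => (gauss z N)^-1) : nat -> R[i]^o)); exists l.
apply: (@cvg_ratio _ _ (expR (cnorm z) * K) 0); first by rewrite mulr_ge0 ?expR_ge0.
move=> N _.
have -> : (gauss z N.+2)^-1 - (gauss z N.+1)^-1 = (gauss z N.+1)^-1 * (cexp (- (z * (lnstep R N)%:C)) * - E N).
  set w := z * _.
  have e : (gauss z N.+2)^-1 = (gauss z N.+1)^-1 * ((1 + z / N.+2%:R) * cexp (- w)).
    apply: (mulfI (gauss_neq0 N.+2 zP)); rewrite divff ?gauss_neq0//.
    rewrite mulrCA [_ * (_ * cexp _)]mulrA gaussS// -/w.
    by rewrite -mulrA [cexp w * _]mulrC cexpNM mulr1 mulVf// gauss_neq0.
  rewrite e -{2}[(gauss z N.+1)^-1]mulr1 -mulrBr; congr (_ * _).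
  by rewrite /E -/w mulrN 2!mulrBr cexpNM; ring.
rewrite cnormM ler_wpM2l ?cnorm_ge0// cnormM cnormN -mulrA.
rewrite ler_pM ?cnorm_ge0//; last exact: cexp_lnstep.
rewrite (le_trans (cnorm_cexp _))// ler_expR cnormN cnormM cnorm_real.
have /andP[h1 h2] := lnstep_bounds R N.
rewrite ler_piMr ?cnorm_ge0// ger0_norm ?(le_trans _ h1) ?invr_ge0// (le_trans h2)//.
by rewrite invf_le1// ler1n.
Qed.
End Gauss_cvg.

Lemma GammaP (R : realType) (z : R[i]) : ~ nonpos_int z ->
  (gauss z : nat -> R[i]^o) @ \oo --> (Gamma z : R[i]^o).
Proof.
by move=> zP; have [l h] := cvg_gauss zP; rewrite /Gamma (cvg_lim (@norm_hausdorff _ _) h).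
Qed.

Lemma Gamma_neq0 (R : realType) (z : R[i]) : ~ nonpos_int z -> Gamma z != 0.
Proof.
move=> zP; have [l h] := cvg_gaussV zP; have := cvgM (GammaP zP) h.
rewrite (_ : _ \* _ = (fun=> 1)); last first.
  by apply/funext => N /=; rewrite divff// gauss_neq0.
move=> h1; apply/eqP => G0; rewrite G0 mul0r in h1.
have := cvg_lim (@norm_hausdorff _ (R[i]^o)) (h1 _); rewrite lim_cst; last exact: norm_hausdorff.
by move=> /(_ _ _)/eqP; rewrite oner_eq0.
Qed.

(** * The functional equation and factorial values *)

Lemma Re_gt0_nonpole (R : realType) (z : R[i]) : 0 < complex.Re z -> ~ nonpos_int z.
Proof.
move=> z0 [j zj]; move: z0; rewrite zj -(rmorph_nat (real_complex R)) /=.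
by rewrite oppr_gt0 ltNge ler0n.
Qed.

Lemma cvg_1Dharmonic (R : realType) (c : R[i]) :
  ((fun N : nat => 1 + c / N.+1%:R) : nat -> R[i]^o) @ \oo --> (1 : R[i]^o).
Proof.
have h0 : ((fun N : nat => (N.+1%:R)^-1) : nat -> R[i]^o) @ \oo --> (0 : R[i]^o).
  have e N : (N.+1%:R)^-1 = (N.+1%:R^-1)%:C :> R[i].
    by rewrite fmorphV /= rmorph_nat.
  apply: cvg_complex => /=.
    under eq_cvg do rewrite e /=.
    exact: cvg_harmonic.
  under eq_cvg do rewrite e /=.
  exact: cvg_cst.
have := cvgD (cvg_cst (1 : R[i]^o)) (cvgM (cvg_cst (c : R[i]^o)) h0).
by rewrite mulr0 addr0; apply.
Qed.

Lemma rising_shift (R : realType) (z : R[i]) (k : nat) :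
  rising z k.+1 = z * rising (z + 1) k.
Proof.
rewrite /rising big_ord_recl addr0; congr (_ * _); apply: eq_bigr => i _.
by rewrite lift0 -addrA nat1r.
Qed.

Lemma cexp_lnD1 (R : realType) (z : R[i]) (N : nat) :
  cexp ((z + 1) * (ln (N.+1%:R : R))%:C) = cexp (z * (ln (N.+1%:R : R))%:C) * N.+1%:R.
Proof.
rewrite mulrDl mul1r cexpD cexp_real lnK ?rmorph_nat//.
by rewrite posrE.
Qed.

Lemma cvg_gaussS (R : realType) (z : R[i]) : ~ nonpos_int z ->
  ((fun N => gauss z N.+1) : nat -> R[i]^o) @ \oo --> (Gamma z : R[i]^o).
Proof.
move=> zP; rewrite (_ : (fun N => gauss z N.+1) = (fun N => gauss z (N + 1)%N)).
  by rewrite (cvg_shiftn 1 (gauss z : nat -> R[i]^o)); exact: GammaP.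
by apply/funext => N; rewrite addn1.
Qed.

(** For [N > 0], [gauss (z + 1) N * (1 + (z + 1) / N) = z * gauss z N], and the extra factor
    tends to 1. *)
Lemma Gamma_shift (R : realType) (z : R[i]) : ~ nonpos_int z ->
  Gamma (z + 1) = z * Gamma z.
Proof.
move=> zP.
have z1P : ~ nonpos_int (z + 1).
  by move=> [j zj]; apply: zP; exists j.+1; rewrite -natr1 opprD -zj addrK.
have := cvgM (cvg_gaussS z1P) (cvg_1Dharmonic (z + 1)) => /(_ _).
have -> : (fun N => gauss (z + 1) N.+1) \* (fun N => 1 + (z + 1) / N.+1%:R) =
    (fun N => z * gauss z N.+1).
  apply/funext => N /=; rewrite /gauss cexp_lnD1 (rising_shift z) [rising (z + 1) N.+2]risingS.
  have z0 : z != 0 by rewrite -[z]addr0; exact: (addn_nonpole 0 zP).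
  have h1 := rising_neq0 N.+1 z1P.
  have h2 := addn_nonpole N.+1 z1P.
  have h3 : N.+1%:R != 0 :> R[i] by rewrite pnatr_eq0.
  by move: (N.+1%:R : R[i]) h2 h3 => s h2 h3; field; rewrite z0 h1 h2 h3.
rewrite mulr1 => h.
have h' := cvgM (cvg_cst (z : R[i]^o)) (cvg_gaussS zP).
by rewrite -(cvg_lim (@norm_hausdorff _ (R[i]^o)) h) (cvg_lim (@norm_hausdorff _ (R[i]^o)) (h' _ _)).
Qed.

Lemma rising1 (R : realType) (k : nat) : rising (1 : R[i]) k = k`!%:R.
Proof.
elim: k => [|k IHk]; first by rewrite /rising big_ord0.
by rewrite risingS IHk nat1r -natrM mulnC.
Qed.

Lemma Gamma1 (R : realType) : Gamma (1 : R[i]) = 1.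
Proof.
have P1 : ~ nonpos_int (1 : R[i]) by apply: Re_gt0_nonpole; rewrite /= ltr01.
have := cvgM (cvg_gaussS P1) (cvg_1Dharmonic 1) => /(_ _).
have -> : (fun N => gauss (1 : R[i]) N.+1) \* (fun N => 1 + 1 / N.+1%:R) = (fun=> 1).
  apply/funext => N /=; rewrite /gauss -[X in cexp (X * _)]add0r cexp_lnD1 mul0r cexp0 mul1r.
  rewrite rising1 [N.+2`!]factS natrM -[N.+2%:R]natr1.
  have h1 : N.+1`!%:R != 0 :> R[i] by rewrite pnatr_eq0 -lt0n fact_gt0.
  have h3 : N.+1%:R != 0 :> R[i] by rewrite pnatr_eq0.
  have h2 : N.+1%:R + 1 != 0 :> R[i] by rewrite natr1 pnatr_eq0.
  by move: (N.+1%:R : R[i]) h2 h3 => s h2 h3; field; rewrite h1 h2 h3.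
rewrite mulr1 => h; rewrite -(cvg_lim (@norm_hausdorff _ (R[i]^o)) h) lim_cst//.
Qed.

Lemma Gamma_fact (R : realType) (n : nat) : Gamma (n.+1%:R : R[i]) = n`!%:R.
Proof.
elim: n => [|n IHn]; first by rewrite Gamma1 fact0.
rewrite -[n.+2%:R]natr1 Gamma_shift ?IHn -?natrM ?factS//.
apply: Re_gt0_nonpole; rewrite -(rmorph_nat (real_complex R)) /=.
by rewrite ltr0n.
Qed.

(** * From Gamma values to the abstract recurrence *)

Lemma rGammaE (R : realType) (z : R[i]) : ~ nonpos_int z -> rGamma z = (Gamma z)^-1.
Proof. by move=> zP; rewrite /rGamma; case: asboolP. Qed.

Lemma risingN (R : realType) (n k : nat) : (k <= n)%N ->
  rising (- n%:R : R[i]) k = (-1) ^+ k * (n`!%:R / (n - k)`!%:R).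
Proof.
elim: k => [_|k IHk kn].
  by rewrite /rising big_ord0 subn0 divff ?mulr1// natr_fact_neq0.
rewrite risingS IHk ?(ltnW kn)//.
have e : (n - k)%N = (n - k.+1).+1 by lia.
have -> : - n%:R + k%:R = - (n - k)%:R :> R[i] by rewrite natrB ?(ltnW kn)// opprB addrC.
rewrite e factS natrM exprS.
have h1 := natr_fact_neq0 R[i] (n - k.+1).
have h2 : (n - k.+1).+1%:R != 0 :> R[i] by rewrite pnatr_eq0.
by move: ((n - k.+1).+1%:R : R[i]) h2 => s h2; field; rewrite h1 h2.
Qed.

Definition Gamma_seq (R : realType) (alpha beta : R[i]) (k : nat) : R[i] :=
  Gamma (alpha * k%:R + beta + 1).

Section Assembly.
Variables (R : realType) (alpha beta : R[i]) (n : nat).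
Hypothesis nonpole : forall k, (k <= n)%N -> ~ nonpos_int (alpha * k%:R + beta + 1).
Local Notation g := (Gamma_seq alpha beta).

Lemma Gamma_seq_neq0 k : (k <= n)%N -> g k != 0.
Proof. by move=> kn; apply/Gamma_neq0/nonpole. Qed.

Lemma rGamma_seq k : (k <= n)%N -> rGamma (alpha * k%:R + beta + 1) = (g k)^-1.
Proof. by move=> kn; rewrite rGammaE//; exact: nonpole. Qed.

Lemma L_laguerre_of (z : R[i]) : L alpha beta n z = laguerre_of g n z.
Proof.
rewrite /L /laguerre_of natr1 Gamma_fact -mulrA; congr (_ * _).
rewrite big_mkord mulr_sumr; apply: eq_bigr => k _.
have kn : (k <= n)%N by rewrite -ltnS.
rewrite rGamma_seq// risingN// (exprNn z).
have h1 := natr_fact_neq0 R[i] n; have h2 := natr_fact_neq0 R[i] k.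
have h3 := natr_fact_neq0 R[i] (n - k); have h4 := Gamma_seq_neq0 kn.
by field; rewrite h1 h2 h3 h4.
Qed.

Lemma falling_ratio k : (0 < k <= n)%N ->
  falling (alpha * k%:R + beta) alpha = g k / g k.-1.
Proof.
case: k => // k /= kn; rewrite /falling -rGamma_seq ?(ltnW kn)//; congr (_ * rGamma _).
by rewrite -natr1; ring.
Qed.

Lemma B_differenceB k m : (0 < m <= k)%N -> (k <= n)%N -> B alpha beta k m = differenceB g k m.
Proof.
move=> /andP[m0 mk] kn; have k0 := leq_trans m0 mk.
rewrite /B /differenceB; congr (_ * _).
  rewrite /falling -rGamma_seq ?(leq_trans (leq_subr _ _))//.
  case: k k0 mk kn => // k _ mk kn; case: m m0 mk => // m _ mk.
  rewrite subSS natrB// -!natr1 addrK /Gamma_seq /=; congr (_ * rGamma _).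
  by ring.
rewrite /C /fdiff mul1r mulrC big_mkord; congr (_ * _).
apply: eq_bigr => j _; have jm : (j <= m)%N by rewrite -ltnS.
rewrite -mulrA; congr (_ * _); rewrite -natrB ?(leq_trans jm)// /weighted_ratio.
(* At j = k the argument of falling may be a pole, but its coefficient is 0. *)
have [->|kj0] := posnP (k - j); first by rewrite !mul0r.
by rewrite falling_ratio// kj0 (leq_trans (leq_subr _ _)).
Qed.

Lemma laguerre_mx_hessenberg (z : R[i]) :
  laguerre_mx alpha beta n z = hessenberg n (laguerre_entry g z).
Proof.
apply/matrixP => r c; rewrite !mxE.
have rn := ltn_ord r; have cn := ltn_ord c.
rewrite eq_sym [in RHS]leq_eqVlt; have [<-|rc /=] := eqVneq (nat_of_ord c) r.
  by rewrite /= subnn /laguerre_entry eqxx B_differenceB//; lia.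
case: ltnP => // cr; rewrite /laguerre_entry addn1 B_differenceB; [|lia..].
by rewrite ifF ?subr0//; apply/negbTE; lia.
Qed.

End Assembly.

(** For [alpha = 1] the sequence under the difference is [(k - j) * (k - j + beta)],
    a quadratic polynomial in [j]. *)
Lemma B1_eq0 (R : realType) (beta : R[i]) (k m : nat) :
  (forall j, (j < k)%N -> ~ nonpos_int (j%:R + beta + 1)) ->
  (2 < m <= k)%N -> B 1 beta k m = 0.
Proof.
move=> bP /andP[m2 mk]; rewrite /B /C.
suff -> : \sum_(0 <= j < m.+1) (-1) ^+ j * 'C(m, j)%:R * (k%:R - j%:R) *
     falling (1 * (k%:R - j%:R) + beta) 1 =
   fdiff m (fun j => k%:R * (k%:R + beta) + (- (2 * k%:R + beta)) * j%:R + 1 * j%:R ^+ 2).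
  by rewrite fdiff_quadratic// !mulr0.
rewrite big_mkord; apply: eq_bigr => j _; rewrite -mulrA; congr (_ * _).
have jk : (j <= k)%N by rewrite (leq_trans _ mk)// -ltnS.
have [jk0|kj0] := posnP (k - j).
  have -> : j = k :> nat by lia.
  by rewrite subrr mul0r; ring.
have -> : falling (1 * (k%:R - j%:R) + beta) 1 = k%:R - j%:R + beta.
  rewrite /falling mul1r subrK.
  have P : ~ nonpos_int (k%:R - j%:R + beta).
    have := bP (k - j.+1)%N; rewrite natrB; last lia.
    by rewrite -natr1 opprD addrA -[_ - 1 + beta + 1]addrA addrACA addNr addr0; apply; lia.
  by rewrite Gamma_shift// rGammaE// mulfK// Gamma_neq0.
by ring.
Qed.

Lemma Re_nat_nonpole (R : realType) (beta : R[i]) (k : nat) :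
  -1 < complex.Re beta -> ~ nonpos_int (k%:R + beta + 1).
Proof.
move=> hb; apply: Re_gt0_nonpole; rewrite -(rmorph_nat (real_complex R)).
case: beta hb => a b /= ha; have : 0 <= k%:R :> R by []; lra.
Qed.

Theorem theorem2 (R : realType) (beta : R[i]) (hbeta : -1 < complex.Re beta)
    (n : nat) (hn : (1 <= n)%N) :
  (forall alpha : R[i],
     (forall k : nat, (k <= n)%N ->
        ~ nonpos_int (alpha * k%:R + beta + 1)) ->
     forall z : R[i],
       L alpha beta n z = \det (laguerre_mx alpha beta n z))
  /\ (forall a : nat, (0 < a)%N ->
        forall k : nat, (k <= n)%N ->
          ~ nonpos_int ((a%:R : R[i]) * k%:R + beta + 1))
  /\ (forall z : R[i],
        L 1 beta n z = \det (laguerre_tridiag_mx beta n z)).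
Proof.
have part1 (alpha : R[i]) : (forall k : nat, (k <= n)%N ->
    ~ nonpos_int (alpha * k%:R + beta + 1)) ->
    forall z, L alpha beta n z = \det (laguerre_mx alpha beta n z).
  move=> nonpole z; rewrite L_laguerre_of// laguerre_mx_hessenberg// det_laguerre_of//.
  by move=> k; exact: Gamma_seq_neq0.
split=> //; split=> [a _ k _|z].
  by rewrite -natrM; exact: Re_nat_nonpole.
rewrite part1 => [|k _]; last by rewrite mul1r; exact: Re_nat_nonpole.
congr (\det _); apply/matrixP => r c; rewrite !mxE.
case: eqVneq => // rc.
have rn := ltn_ord r; have cn := ltn_ord c.
case: ltnP => cr; last by rewrite (ltn_eqF (_ : r < c.+1)%N).
have [->|rc1] := eqVneq (nat_of_ord r) c.+1; first by rewrite subSnn.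
rewrite B1_eq0 => [|j _|]; [|exact: Re_nat_nonpole|lia].
by rewrite ifF//; apply/negbTE; lia.
Qed.
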